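(* Let $X$ and $Y$ be compact manifolds, and let $\varPsi:\mathcal{C}^\infty(X)\to\mathcal{C}^\infty(Y)$ be an algebra isomorphism. Then there exists a unique diffeomorphism $\psi:Y\to X$ such that $$\varPsi(f)=f\circ\psi\quad\text{for all }f\in\mathcal{C}^\infty(X).$$
   Context: Manifolds are finite dimensional, smooth, Hausdorff and second countable. $\mathbb{K}$ denotes $\mathbb{R}$ or $\mathbb{C}$, and $\mathcal{C}^\infty(X)=\mathcal{C}^\infty(X,\mathbb{K})$ is the $\mathbb{K}$-algebra of smooth $\mathbb{K}$-valued functions on $X$ with pointwise operations. Algebra isomorphisms are isomorphisms of $\mathbb{K}$-algebras. *)

(* Defs.v *)
From HB Require Import structures.
From mathcomp Require Import all_boot all_order all_algebra.
From mathcomp Require Import all_classical all_reals all_analysis.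
From mathcomp Require Import complex.
Import Order.TTheory GRing.Theory Num.Theory.
Import numFieldNormedType.Exports.

Set Implicit Arguments.
Unset Strict Implicit.
Unset Printing Implicit Defensive.

Local Open Scope classical_set_scope.
Local Open Scope ring_scope.

(* [f] is of class C^k on [U]; only meant for open [U].  The derivative of [f]
   is represented by the family of all directional derivatives ['D_v f]. *)
Fixpoint Ck_on (R : realType) (V W : normedModType R) (k : nat)
    (U : set V) (f : V -> W) : Prop :=
  match k with
  | 0 => forall x, U x -> {for x, continuous f}
  | k'.+1 => (forall x, U x -> differentiable f x) /\
             (forall v, Ck_on k' U ('D_v f))
  end.

Definition smooth_on (R : realType) (V W : normedModType R)
    (U : set V) (f : V -> W) : Prop :=
  forall k, Ck_on k U f.

(* The maps of a chart are total; only their values on [chart_dom] and on its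
   image are relevant. *)
Record chart (R : realType) (T : topologicalType) := Chart {
  chart_dim : nat;
  chart_dom : set T;
  chart_map : T -> 'rV[R]_chart_dim;
  chart_inv : 'rV[R]_chart_dim -> T;
  chart_dom_open : open chart_dom;
  chart_img_open : open (chart_map @` chart_dom);
  chart_mapK : forall x, chart_dom x -> chart_inv (chart_map x) = x;
  chart_map_continuous :
    forall x, chart_dom x -> {for x, continuous chart_map};
  chart_inv_continuous :
    forall y, (chart_map @` chart_dom) y -> {for y, continuous chart_inv}
}.
Arguments chart_map {R T} c : rename.
Arguments chart_inv {R T} c : rename.

(* The smooth structure is given by an atlas that need not be maximal.  The
   dimension may depend on the connected component, and the empty manifold is
   allowed. *)
Record manifold (R : realType) := Manifold {
  manifold_carrier :> topologicalType;
  atlas : set (chart R manifold_carrier);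
  manifold_hausdorff : hausdorff_space manifold_carrier;
  manifold_second_countable : @second_countable manifold_carrier;
  atlas_cover : forall x, exists2 c, atlas c & chart_dom c x;
  atlas_compatible : forall c d, atlas c -> atlas d ->
    smooth_on (chart_map c @` (chart_dom c `&` chart_dom d))
              (chart_map d \o chart_inv c)
}.

Definition smooth_map (R : realType) (Y X : manifold R) (psi : Y -> X) : Prop :=
  continuous psi /\
  forall c d, atlas c -> atlas d ->
    smooth_on (chart_map c @` (chart_dom c `&` psi @^-1` chart_dom d))
              (chart_map d \o psi \o chart_inv c).

Definition diffeomorphism (R : realType) (Y X : manifold R) (psi : Y -> X) :
    Prop :=
  exists phi : X -> Y,
    [/\ cancel psi phi, cancel phi psi, smooth_map psi & smooth_map phi].

Inductive scalar_kind := RealScalars | ComplexScalars.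

Definition scalars (R : realType) (K : scalar_kind) : numFieldType :=
  match K with RealScalars => R | ComplexScalars => R[i] end.

Definition smooth_real_fun (R : realType) (X : manifold R) (f : X -> R) :
    Prop :=
  forall c, atlas c ->
    smooth_on (chart_map c @` chart_dom c) (f \o chart_inv c).

Definition smooth_fun (R : realType) (K : scalar_kind) (X : manifold R) :
    (X -> scalars R K) -> Prop :=
  match K with
  | RealScalars => fun f => smooth_real_fun f
  | ComplexScalars => fun f =>
      smooth_real_fun (fun x => complex.Re (f x)) /\
      smooth_real_fun (fun x => complex.Im (f x))
  end.

Section Closure.
Variable R : realType.

Section Ck.
Variable V : normedModType R.
Implicit Types (U : set V) (f g : V -> R).

Lemma near_eq_differentiable f g (x : V) :
  {near x, f =1 g} -> differentiable f x -> differentiable g x.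
Proof.
move=> fg df; have [dfc dfE] := (diff_locallyP x f).1 df.
have gE : g \o shift x = cst (g x) + 'd f x +o_ 0 id.
  apply/eqaddoP => e e0; have /eqaddoP /(_ e e0) := dfE.
  have : \forall h \near 0, f (h + x) = g (h + x).
    have /nbhs0P := fg; apply: filterS => h.
    by rewrite addrC.
  apply: filterS2 => h; rewrite !fctE /= => ->.
  by rewrite (nbhs_singleton fg).
by apply/diff_locallyP; rewrite (diff_unique dfc gE).
Qed.

Lemma Ck_on_ext k U f g : open U -> (forall x, U x -> f x = g x) ->
  Ck_on k U f -> Ck_on k U g.
Proof.
move=> oU; elim: k f g => [|k IH] f g fg /=.
  move=> cf x Ux; have fgx : {near x, f =1 g}.
    by near=> y; apply: fg; near: y; exact: open_nbhs_nbhs.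
  rewrite /prop_for /continuous_at -(fg _ Ux).
  exact: cvg_trans (near_eq_cvg fgx) (cf x Ux).
move=> [df Df]; split=> [x Ux|v].
  have fgx : {near x, f =1 g}.
    by near=> y; apply: fg; near: y; exact: open_nbhs_nbhs.
  exact: (near_eq_differentiable _ (df x Ux)).
apply: IH (Df v) => x Ux.
by apply: near_eq_derive; near=> y; apply: fg; near: y; exact: open_nbhs_nbhs.
Unshelve. all: by end_near. Qed.

Lemma Ck_onS k U f : Ck_on k.+1 U f -> Ck_on k U f.
Proof.
elim: k f => [|k IH] f [df Df].
  by move=> x Ux; exact/differentiable_continuous/df.
by split=> // v; exact: IH (Df v).
Qed.

Lemma Ck_on_cst k U (a : R) : Ck_on k U (cst a).
Proof.
elim: k a => [|k IH] a /=; first by move=> x _; exact: cvg_cst.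
split=> [//|v]; suff -> : 'D_v (cst a : V -> R) = cst 0 by exact: IH.
by apply/funext => x; rewrite derive_cst.
Qed.

Lemma Ck_onD k U f g : open U -> Ck_on k U f -> Ck_on k U g ->
  Ck_on k U (f + g).
Proof.
move=> oU; elim: k f g => [|k IH] f g /=.
  by move=> cf cg x Ux; apply: continuousD; [exact: cf|exact: cg].
move=> [df Df] [dg Dg]; split=> [x Ux|v].
  by apply: differentiableD; [exact: df|exact: dg].
apply: Ck_on_ext (IH _ _ (Df v) (Dg v)) => // x Ux.
by rewrite deriveD//; apply: diff_derivable; [exact: df|exact: dg].
Qed.

Lemma Ck_onM k U f g : open U -> Ck_on k U f -> Ck_on k U g ->
  Ck_on k U (f * g).
Proof.
move=> oU; elim: k f g => [|k IH] f g.
  by move=> cf cg x Ux; apply: continuousM; [exact: cf|exact: cg].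
move=> /[dup] /Ck_onS fk [df Df] /[dup] /Ck_onS gk [dg Dg]; split=> [x Ux|v].
  by apply: differentiableM; [exact: df|exact: dg].
apply: Ck_on_ext (Ck_onD oU (IH _ _ fk (Dg v)) (IH _ _ gk (Df v))) => // x Ux.
by rewrite deriveM//; apply: diff_derivable; [exact: df|exact: dg].
Qed.

End Ck.

Variable X : manifold R.

Lemma smooth_real_fun_cst (a : R) : smooth_real_fun (cst a : X -> R).
Proof. by move=> c _ k; exact: Ck_on_cst. Qed.

Lemma smooth_real_funD (f g : X -> R) :
  smooth_real_fun f -> smooth_real_fun g -> smooth_real_fun (f + g).
Proof.
move=> sf sg c ac k.
by apply: Ck_onD (sf c ac k) (sg c ac k); exact: chart_img_open.
Qed.

Lemma smooth_real_funM (f g : X -> R) :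
  smooth_real_fun f -> smooth_real_fun g -> smooth_real_fun (f * g).
Proof.
move=> sf sg c ac k.
by apply: Ck_onM (sf c ac k) (sg c ac k); exact: chart_img_open.
Qed.

Lemma smooth_real_funN (f : X -> R) :
  smooth_real_fun f -> smooth_real_fun (- f).
Proof.
move=> sf; rewrite -mulN1r; apply: smooth_real_funM => //.
exact: (smooth_real_fun_cst (-1)).
Qed.

Variable K : scalar_kind.
Implicit Types f g : X -> scalars R K.

Lemma smooth_fun_cst (a : scalars R K) : smooth_fun (cst a : X -> scalars R K).
Proof.
case: K a => a /=; first exact: smooth_real_fun_cst.
by split; [exact: (smooth_real_fun_cst (complex.Re a))
          |exact: (smooth_real_fun_cst (complex.Im a))].
Qed.

Lemma smooth_funD f g : smooth_fun f -> smooth_fun g -> smooth_fun (f + g).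
Proof.
case: K f g => /= f g; first exact: smooth_real_funD.
move=> [fr fi] [gr gi]; split.
  rewrite (_ : (fun _ => _) =
      (fun x => complex.Re (f x)) + (fun x => complex.Re (g x))).
    exact: smooth_real_funD.
  by apply/funext => x; rewrite !fctE; case: (f x) (g x) => [? ?] [].
rewrite (_ : (fun _ => _) =
    (fun x => complex.Im (f x)) + (fun x => complex.Im (g x))).
  exact: smooth_real_funD.
by apply/funext => x; rewrite !fctE; case: (f x) (g x) => [? ?] [].
Qed.

Lemma smooth_funM f g : smooth_fun f -> smooth_fun g -> smooth_fun (f * g).
Proof.
case: K f g => /= f g; first exact: smooth_real_funM.
move=> [fr fi] [gr gi]; split.
  rewrite (_ : (fun _ => _) =
      (fun x => complex.Re (f x)) * (fun x => complex.Re (g x)) -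
      (fun x => complex.Im (f x)) * (fun x => complex.Im (g x))).
    by apply: smooth_real_funD; last apply: smooth_real_funN;
      exact: smooth_real_funM.
  by apply/funext => x; rewrite !fctE; case: (f x) (g x) => [? ?] [].
rewrite (_ : (fun _ => _) =
    (fun x => complex.Re (f x)) * (fun x => complex.Im (g x)) +
    (fun x => complex.Im (f x)) * (fun x => complex.Re (g x))).
  by apply: smooth_real_funD; exact: smooth_real_funM.
by apply/funext => x; rewrite !fctE; case: (f x) (g x) => [? ?] [].
Qed.

End Closure.

(* Functions take their values in [(scalars R K)^o], which is [scalars R K]
   seen as a module over itself, so that they can be scaled. *)
Definition smooth_pred (R : realType) (K : scalar_kind) (X : manifold R) :
    {pred X -> (scalars R K)^o} :=
  [pred f | `[< @smooth_fun R K X f >]].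

Section SmoothPred.
Variables (R : realType) (K : scalar_kind) (X : manifold R).

Lemma smooth_predP (f : X -> (scalars R K)^o) :
  reflect (@smooth_fun R K X f) (f \in @smooth_pred R K X).
Proof. exact: asboolP. Qed.

Fact smooth_pred_subring : subring_closed (@smooth_pred R K X).
Proof.
split=> [|f g|f g].
- by apply/smooth_predP; exact: (@smooth_fun_cst R X K 1).
- move=> /smooth_predP sf /smooth_predP sg; apply/smooth_predP.
  rewrite -[- g]mulN1r; apply: smooth_funD => //.
  by apply: smooth_funM => //; exact: (@smooth_fun_cst R X K (-1)).
- move=> /smooth_predP sf /smooth_predP sg; apply/smooth_predP.
  exact: smooth_funM.
Qed.

HB.instance Definition _ := GRing.isSubringClosed.Build _
  (@smooth_pred R K X) smooth_pred_subring.

Fact smooth_pred_scaler : GRing.scaler_closed (@smooth_pred R K X).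
Proof.
move=> a f /smooth_predP sf; apply/smooth_predP.
apply: (@smooth_funM R X K (cst a) f) => //.
exact: (@smooth_fun_cst R X K a).
Qed.

HB.instance Definition _ := GRing.isScaleClosed.Build _ _
  (@smooth_pred R K X) smooth_pred_scaler.

End SmoothPred.

Record Cinfty (R : realType) (K : scalar_kind) (X : manifold R) := MkCinfty {
  Cinfty_fun :> X -> (scalars R K)^o;
  Cinfty_smooth : Cinfty_fun \in @smooth_pred R K X
}.

HB.instance Definition _ R K X := [isSub for @Cinfty_fun R K X].
HB.instance Definition _ R K X := [Choice of @Cinfty R K X by <:].
HB.instance Definition _ R K X := GRing.SubChoice_isSubComPzRing.Build _ _
  (@Cinfty R K X) (subringClosedP _).
HB.instance Definition _ R K X :=
  [SubZmodule_isSubLmodule of @Cinfty R K X by <:].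

(* A bijective homomorphism of unital K-algebras.  It is stated for a ring with
   a module structure because the algebras of the library are nonzero, whereas
   the algebra of smooth functions on the empty manifold is zero. *)
Definition algebra_isomorphism (R : realType) (K : scalar_kind)
    (X Y : manifold R) (Psi : Cinfty K X -> Cinfty K Y) : Prop :=
  [/\ linear Psi, monoid_morphism Psi & bijective Psi].

(* Main.v *)
Require Import Defs.
From HB Require Import structures.
From mathcomp Require Import all_boot all_order all_algebra.
From mathcomp Require Import all_classical all_reals all_analysis.
From mathcomp Require Import complex ring.
Import Order.TTheory GRing.Theory Num.Theory.
Import numFieldNormedType.Exports.

Set Implicit Arguments.
Unset Strict Implicit.
Unset Printing Implicit Defensive.

Local Open Scope classical_set_scope.
Local Open Scope ring_scope.

(** The points of a compact manifold [X] can be recovered from the algebra of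
    its smooth functions as the characters of that algebra, that is, as its
    unital algebra morphisms to the scalars.

    Every character [chi] is the evaluation at some point
    ([character_eval]).  A function [f] with [chi f = 0] must vanish somewhere:
    otherwise [|f|^2] has a smooth inverse, and [chi 1] would be a multiple of
    [chi f].  Since [|f1|^2 + |f2|^2] again lies in the kernel of [chi], the
    zero sets of the functions of the kernel are closed under intersection.
    They thus generate a proper filter of closed sets, and compactness gives a
    point [x] that belongs to all of them.  As [f - chi f] lies in the kernel
    for all [f], [chi f = f x].

    For [y] in [Y], [f |-> Psi f y] is a character of the functions on [X], so
    it is the evaluation at a point [psi y]: this defines [psi] with
    [Psi f = f \o psi], and the inverse of [Psi] gives similarly a map
    [phi : X -> Y].  Smooth functions separate points, because bump functions
    exist ([exists_bump]); so [psi] is unique and [phi] is its inverse.  Finally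
    a map that pulls smooth functions back to smooth functions is smooth
    ([smooth_map_pullback]): bump functions yield its continuity, and around a
    given point a coordinate function is the quotient of two globally defined
    smooth functions, the coordinate multiplied by a bump function and the bump
    function itself.

    Bump functions are built in a chart as the product over the coordinates
    [x_i] of [h (r^2 - (x_i - p_i)^2)], where [h t] is [exp (- 1 / t)] for
    [t > 0] and [0] otherwise.  Their smoothness is proved for the coordinates
    replaced by arbitrary smooth real functions, such as the coordinates read
    in another chart: products and the composition with [h] on the left are the
    only operations involved. *)

(** * Functions of class C^k on a normed module *)

Section CkOn.
Context {R : realType} {V : normedModType R}.
Implicit Types (U N : set V).

Lemma Ck_on_subset (W : normedModType R) k N U (f : V -> W) : N `<=` U ->
  Ck_on k U f -> Ck_on k N f.
Proof.
move=> NU; elim: k f => [|k IH] f /=; first by move=> + x /NU; exact.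
by move=> [df Df]; split=> [x /NU/df//|v]; exact: IH (Df v).
Qed.

(** Locality lets smoothness be checked around each point by means of a formula
    for [f] that is valid only there. *)
Lemma Ck_on_local (W : normedModType R) k U (f : V -> W) :
  (forall x, U x -> exists2 N, N x & Ck_on k N f) -> Ck_on k U f.
Proof.
elim: k f => [|k IH] f Uf.
  by move=> x /Uf[N Nx]; exact.
split=> [x /Uf[N Nx [+ _]]|v]; first exact.
by apply: IH => x /Uf[N Nx [_ /(_ v)]]; exists N.
Qed.

Lemma Ck_on_prod k U (I : Type) (s : seq I) (f : I -> V -> R) : open U ->
  (forall i, Ck_on k U (f i)) -> Ck_on k U (fun x => \prod_(i <- s) f i x).
Proof.
move=> oU kf; elim: s => [|i s IH].
  by apply: Ck_on_ext (Ck_on_cst k U 1) => // x _; rewrite big_nil.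
by apply: Ck_on_ext (Ck_onM oU (kf i) IH) => // x _; rewrite big_cons.
Qed.

Lemma Ck_onV k U (f : V -> R) : open U -> (forall x, U x -> f x != 0) ->
  Ck_on k U f -> Ck_on k U (fun x => (f x)^-1).
Proof.
move=> oU f0; elim: k => [|k IH].
  by move=> cf x Ux; apply: continuousV; [exact: f0|exact: cf].
move=> /[dup] /Ck_onS/IH fVk [df Df]; split=> [x Ux|v].
  by apply: differentiableV; [exact: df|exact: f0].
apply: (@Ck_on_ext _ _ _ _ (cst (-1) * ((fun x => (f x)^-1) *
    (fun x => (f x)^-1) * 'D_v f))) => // [x Ux|].
  rewrite deriveV ?f0//; last exact/diff_derivable/df.
  by rewrite !fctE mulN1r scaleNr -exprVn expr2.
by do !apply: Ck_onM => //; [exact: Ck_on_cst|exact: Df].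
Qed.

Lemma Ck_on_coord k U n (f : V -> 'rV[R]_n) i : open U ->
  Ck_on k U f -> Ck_on k U (fun x => f x ord0 i).
Proof.
move=> oU; elim: k f => [|k IH] f.
  move=> cf x Ux; apply: (@continuous_comp _ _ _ f (fun M : 'rV_n => M ord0 i)).
    exact: cf.
  exact: coord_continuous.
move=> [df Df]; split=> [x Ux|v].
  apply: (@differentiable_comp _ _ _ _ f (fun M : 'rV_n => M ord0 i)).
    exact: df.
  exact: differentiable_coord.
apply: Ck_on_ext (IH _ (Df v)) => // x Ux.
by rewrite derive_mx ?mxE//; exact/diff_derivable/df.
Qed.

Lemma differentiable_row n (f : V -> 'rV[R]_n) x :
  (forall i, differentiable (fun x => f x ord0 i) x) -> differentiable f x.
Proof.
move=> df; rewrite [f](_ : _ = \sum_(i < n) (fun x => f x ord0 i *: 'e_i)).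
  by apply: differentiable_sum => i; exact: differentiableZl.
by apply/funext => y; rewrite fct_sumE -row_sum_delta.
Qed.

Lemma continuous_row n (f : V -> 'rV[R]_n) (x : V) :
  (forall i, {for x, continuous (fun x => f x ord0 i)}) ->
  {for x, continuous f}.
Proof.
move=> cf; apply/cvg_ballP => e e0.
have : \forall y \near x, forall i, ball (f x ord0 i) e (f y ord0 i).
  by apply: filter_forall => i; have /cvg_ballP := cf i; exact.
by apply: filterS => y fxy; split=> // i j; rewrite (ord1 i); exact: fxy.
Qed.

(** Vector-valued functions are reduced to real-valued ones, for which the
    closure properties under algebraic operations are available. *)
Lemma Ck_on_row k U n (f : V -> 'rV[R]_n) : open U ->
  (forall i, Ck_on k U (fun x => f x ord0 i)) -> Ck_on k U f.
Proof.
move=> oU; elim: k f => [|k IH] f cf.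
  by move=> x Ux; apply: continuous_row => i; exact: cf.
have df x : U x -> differentiable f x.
  by move=> Ux; apply: differentiable_row => i; have [+ _] := cf i; exact.
split=> // v; apply: IH => i; have [_ /(_ v)] := cf i.
apply: Ck_on_ext => // x Ux.
by rewrite derive_mx ?mxE//; exact/diff_derivable/df.
Qed.

End CkOn.

(** * A smooth function that vanishes exactly on the half-line t <= 0 *)

Section Flat.
Context {R : realType}.

(** [flat 0] is the classical flat function.  The powers of [1 / t] are there to
    have a family that is closed under differentiation, up to linear
    combinations. *)
Definition flat (n : nat) (t : R) : R :=
  if 0 < t then t^-1 ^+ n * expR (- t^-1) else 0.

Lemma flat_gt0 n t : 0 < t -> 0 < flat n t.
Proof.
by move=> t0; rewrite /flat t0 mulr_gt0 ?expR_gt0// exprn_gt0// invr_gt0.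
Qed.

Lemma flat_le0 n t : t <= 0 -> flat n t = 0.
Proof. by rewrite /flat ltNge => ->. Qed.

(** With [u = 1 / t], this is [u^(n + 2) / (n + 2)! <= exp u].  A quadratic
    bound yields the zero derivative of [flat n] at [0]. *)
Lemma normr_flat_le n t : `|flat n t| <= n.+2`!%:R * t ^+ 2.
Proof.
have [t0|t0] := ltP 0 t; last by rewrite flat_le0// normr0 mulr_ge0 ?sqr_ge0.
rewrite gtr0_norm ?flat_gt0// /flat t0.
set u := t^-1; have u0 : 0 < u by rewrite invr_gt0.
rewrite -[t]invrK -/u expRN ler_pdivrMr ?expR_gt0//.
rewrite -mulrA -ler_pdivrMl ?ltr0n ?fact_gt0// mulrC -ler_pdivrMl; last first.
  by rewrite exprn_gt0// invr_gt0.
rewrite exprVn invrK mulrA -exprD add2n.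
by rewrite (le_trans _ (expR_ge1Dxn n.+1 (ltW u0)))// lerDr.
Qed.

Lemma is_derive_flat n (t : R) :
  is_derive t (1 : R) (flat n) (flat n.+2 t - n%:R * flat n.+1 t).
Proof.
have [t0|t0|->] := ltgtP t 0.
- rewrite !flat_le0 ?ltW// mulr0 subr0.
  apply: (near_eq_is_derive _ (is_derive_cst 0 t (1 : R))).
  near=> s; rewrite flat_le0// ltW//; near: s; exact: lt_nbhsl.
- have tN0 : t != 0 by rewrite gt_eqF.
  apply: (@near_eq_is_derive _ _ _
    ((fun s => s^-1) ^+ n * (expR \o - (fun s => s^-1)))).
    near=> s; rewrite /flat ifT ?fctE//.
    near: s; exact: lt_nbhsr.
  have dV := is_deriveV tN0 (is_derive_id t (1 : R)).
  apply: is_derive_eq.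
  rewrite /flat t0 !fctE /= /GRing.scale/= !mulr1 -exprVn.
  move: (t^-1) (expR (- t^-1)) => u E; case: n => [|n] /=; first by ring.
  by rewrite !(exprS u n) !exprS; ring.
- rewrite !flat_le0// mulr0 subr0.
  have cvg0 : h^-1 *: (flat n (h *: 1 + 0) - flat n 0) @[h --> 0^'] --> (0 : R).
    apply: norm_cvg0.
    apply: (@squeeze_cvgr _ _ _ _ (cst 0) (fun h : R => n.+2`!%:R * `|h|)).
    + near=> h; rewrite normr_ge0/= (flat_le0 n (lexx 0)) subr0 addr0.
      have h0 : h != 0 by near: h; exact: nbhs_dnbhs_neq.
      rewrite [h *: 1]mulr1 normrZ normfV ler_pdivrMl ?normr_gt0//.
      rewrite mulrCA -expr2 real_normK ?num_real//.
      exact: normr_flat_le.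
    + exact: cvg_cst.
    + rewrite -[X in _ --> X](mulr0 n.+2`!%:R).
      apply: cvgM; first exact: cvg_cst.
      rewrite -[X in _ --> X](@normr0 _ R); apply: cvg_norm.
      exact: nbhs_dnbhs.
  by apply: DeriveDef; [exact: cvgP cvg0|exact: cvg_lim cvg0].
Unshelve. all: by end_near. Qed.

Lemma differentiable_flat n (t : R) : differentiable (flat n) t.
Proof. by apply/derivable1_diffP; have [] := is_derive_flat n t. Qed.

(** The induction on [k] is for all [n] at once, since the derivative of
    [flat n \o q] involves [flat n.+1 \o q] and [flat n.+2 \o q]. *)
Lemma Ck_on_flat (V : normedModType R) k (U : set V) n (q : V -> R) :
  open U -> Ck_on k U q -> Ck_on k U (flat n \o q).
Proof.
move=> oU; elim: k n => [|k IH] n.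
  move=> cq x Ux; apply: continuous_comp; first exact: cq.
  exact/differentiable_continuous/differentiable_flat.
move=> /[dup] /Ck_onS kq [dq Dq]; split=> [x Ux|v].
  apply: differentiable_comp; first exact: dq.
  exact: differentiable_flat.
apply: (@Ck_on_ext _ _ _ _
    (((flat n.+2 \o q) + cst (- n%:R) * (flat n.+1 \o q)) * 'D_v q)) => //.
  move=> x Ux; have dqx := dq _ Ux; have dflat := differentiable_flat n (q x).
  rewrite deriveE; last exact: differentiable_comp.
  rewrite diff_comp//= -(deriveE v dqx) diff1E// derive1E.
  have [_ ->] := is_derive_flat n (q x).
  by rewrite !fctE /GRing.scale/= mulrC mulNr.
apply: Ck_onM (Dq v) => //; apply: Ck_onD => //; first exact: IH.
by apply: Ck_onM => //; [exact: Ck_on_cst|exact: IH].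
Qed.

End Flat.

(** * Charts, smooth functions and bump functions *)

Section Chart.
Context {R : realType} {T : topologicalType}.
Implicit Types (c : chart R T).

Lemma chart_dom_inv c (A : set T) y :
  (chart_map c @` (chart_dom c `&` A)) y ->
  [/\ chart_dom c (chart_inv c y), A (chart_inv c y) &
      chart_map c (chart_inv c y) = y].
Proof. by move=> [x [cx Ax] <-]; rewrite !chart_mapK. Qed.

(** The charts are homeomorphisms onto open sets, so these images are the open
    sets on which local expressions of functions and maps are studied. *)
Lemma chart_image_open c (A : set T) : open A ->
  open (chart_map c @` (chart_dom c `&` A)).
Proof.
move=> oA; rewrite openE => _ [x [cx Ax] <-]; rewrite /interior/=.
have img : (chart_map c @` chart_dom c) (chart_map c x) by exists x.
have /(_ A) := chart_inv_continuous img.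
rewrite chart_mapK// => /(_ (open_nbhs_nbhs (conj oA Ax))).
have := open_nbhs_nbhs (conj (@chart_img_open _ _ c) img).
apply: filterS2 => _ [z cz <-] /=; rewrite chart_mapK// => Az.
by exists z.
Qed.

End Chart.

Section SmoothFunctions.
Context {R : realType} {X : manifold R}.
Implicit Types (c d : chart R X) (f g b : X -> R) (U C : set X) (p x : X).

Lemma smooth_real_fun_continuous f : smooth_real_fun f -> continuous f.
Proof.
move=> sf x; have [c ac cx] := atlas_cover x.
have : {for x, continuous ((f \o chart_inv c) \o chart_map c)}.
  apply: continuous_comp; first exact: chart_map_continuous.
  by apply: (sf c ac 0); exists x.
rewrite /prop_for /continuous_at /= chart_mapK//; apply: cvg_trans.
apply: near_eq_cvg; near=> z => /=; rewrite chart_mapK//; near: z.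
exact: (open_nbhs_nbhs (conj (@chart_dom_open _ _ c) cx)).
Unshelve. all: by end_near. Qed.

Lemma smooth_real_funV f : (forall x, f x != 0) ->
  smooth_real_fun f -> smooth_real_fun (fun x => (f x)^-1).
Proof.
move=> f0 sf c ac k; apply: (Ck_onV _ _ (sf c ac k)) => [|y _].
  exact: chart_img_open.
exact: f0.
Qed.

Lemma chart_coord_smooth c d i : atlas c -> atlas d ->
  smooth_on (chart_map c @` (chart_dom c `&` chart_dom d))
    (fun y => chart_map d (chart_inv c y) ord0 i).
Proof.
move=> ac ad k; have /= := atlas_compatible ac ad k; apply: Ck_on_coord.
exact/chart_image_open/chart_dom_open.
Qed.

(** Extension by zero: [X] is covered by the open sets [chart_dom d] and
    [~` C], and [f] is smooth on each of them. *)
Lemma smooth_real_fun_extend0 d C f : closed C -> C `<=` chart_dom d ->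
  (forall x, ~ C x -> f x = 0) ->
  (forall c, atlas c -> smooth_on
     (chart_map c @` (chart_dom c `&` chart_dom d)) (f \o chart_inv c)) ->
  smooth_real_fun f.
Proof.
move=> clC Cd f0 sf c ac k; apply: Ck_on_local => _ [x cx <-].
have [dx|ndx] := pselect (chart_dom d x).
  by exists (chart_map c @` (chart_dom c `&` chart_dom d)); [exists x|exact: sf].
exists (chart_map c @` (chart_dom c `&` ~` C)).
  by exists x => //; split=> // /Cd.
apply: (Ck_on_ext _ _ (Ck_on_cst k _ 0)).
  exact/chart_image_open/closed_openC.
by move=> y /chart_dom_inv[_ nC _] /=; rewrite f0.
Qed.

(** The last property makes the coordinates of [d], multiplied by [b], global
    smooth functions, whatever the values of [chart_map d] off its domain. *)
Lemma exists_bump d p U : atlas d -> chart_dom d p -> open U -> U p ->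
  exists b, [/\ smooth_real_fun b, b p != 0,
    forall x, b x != 0 -> chart_dom d x /\ U x &
    forall i, smooth_real_fun (fun x => chart_map d x ord0 i * b x)].
Proof.
move=> ad dp oU Up; pose W := chart_map d @` (chart_dom d `&` U).
have /nbhs_ballP[e /= e0 ballW] : nbhs (chart_map d p) W.
  by apply: open_nbhs_nbhs; split; [exact: chart_image_open|exists p].
(* The closed cube of radius [r] must be contained in the open ball of radius
   [e], hence [r < e]. *)
pose r := e / 2; have r0 : 0 < r by rewrite divr_gt0.
have re : r < e by rewrite /r ltr_pdivrMr// mulr2n mulrDr mulr1 ltrDl.
pose q i x := r ^+ 2 - (chart_map d x ord0 i - chart_map d p ord0 i) ^+ 2.
pose b x := if `[< chart_dom d x >] then \prod_i flat 0 (q i x) else 0.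
have bE x : chart_dom d x -> b x = \prod_i flat 0 (q i x).
  by move=> dx; rewrite /b asboolT.
pose cube := [set v : 'rV[R]_(chart_dim d) |
  forall i, v ord0 i \in `[chart_map d p ord0 i - r, chart_map d p ord0 i + r]].
have cubeW : cube `<=` W.
  move=> v vc; apply: ballW; split=> // i j; rewrite (ord1 i).
  have := vc j; rewrite in_itv/= -ler_distlC => /le_lt_trans; exact.
(* The image of the cube contains the support of [b].  It is compact, hence
   closed as [X] is Hausdorff, which allows extension by zero. *)
have cmpC : compact (chart_inv d @` cube).
  apply: continuous_compact; last first.
    apply: (@rV_compact _ _ (fun i => [set` `[chart_map d p ord0 i - r,
      chart_map d p ord0 i + r]])) => i.
    exact: segment_compact.
  apply: continuous_in_subspaceT => v /set_mem/cubeW[x [dx _] <-].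
  by apply: chart_inv_continuous; exists x.
have bsupp x : b x != 0 -> chart_dom d x /\ (chart_inv d @` cube) x.
  rewrite /b; case: asboolP => [dx bx|]; last by rewrite eqxx.
  split=> //; exists (chart_map d x); last exact: chart_mapK.
  move=> i; rewrite in_itv/= -ler_distlC distrC leNgt.
  apply: contra bx => ltr; rewrite (bigD1 i)//= flat_le0 ?mul0r//.
  by rewrite subr_le0 -[leRHS]real_normK ?num_real// lerXn2r ?nnegrE// ltW.
have sb c : atlas c -> smooth_on
    (chart_map c @` (chart_dom c `&` chart_dom d)) (b \o chart_inv c).
  move=> ac k; set N := chart_map c @` _.
  have oN : open N by exact/chart_image_open/chart_dom_open.
  apply: (@Ck_on_ext _ _ _ _
      (fun y => \prod_i flat 0 (q i (chart_inv c y)))) => //.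
    by move=> y /chart_dom_inv[_ dy _] /=; rewrite bE.
  apply: Ck_on_prod => // i.
  apply: (Ck_on_flat 0 oN (q := (fun y => q i (chart_inv c y)))).
  have sq : Ck_on k N ((fun y => chart_map d (chart_inv c y) ord0 i) +
      cst (- chart_map d p ord0 i)).
    by apply: Ck_onD => //; [exact: chart_coord_smooth|exact: Ck_on_cst].
  have sq2 := Ck_onM oN (Ck_on_cst k N (-1)) (Ck_onM oN sq sq).
  apply: Ck_on_ext (Ck_onD oN (Ck_on_cst k N (r ^+ 2)) sq2) => // y _.
  by rewrite /q !fctE mulN1r expr2.
have clC := compact_closed (@manifold_hausdorff _ X) cmpC.
have Cd : chart_inv d @` cube `<=` chart_dom d.
  by move=> _ [v /cubeW/chart_dom_inv[? ? ?] <-].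
have b0 x : ~ (chart_inv d @` cube) x -> b x = 0.
  by move=> nCx; apply/eqP/negPn/negP => /bsupp[].
exists b; split.
- exact: smooth_real_fun_extend0 clC Cd b0 sb.
- rewrite bE// gt_eqF//; apply: prodr_gt0 => i _; apply: flat_gt0.
  by rewrite /q subrr expr0n/= subr0 exprn_gt0.
- by move=> x /bsupp[_ [v /cubeW/chart_dom_inv[dv Uv _] <-]].
- move=> i; apply: (smooth_real_fun_extend0 clC Cd) => [x /b0 ->|c ac k].
    by rewrite mulr0.
  apply: Ck_onM; [exact/chart_image_open/chart_dom_open| |exact: sb].
  exact: chart_coord_smooth.
Qed.

Lemma smooth_real_fun_separates p x : p <> x ->
  exists2 b, smooth_real_fun b & b p != b x.
Proof.
move=> px; have [d ad dp] := atlas_cover p.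
have oU : open (~` [set x]).
  apply/closed_openC/accessible_closed_set1/hausdorff_accessible.
  exact: manifold_hausdorff.
have [b [sb bp bU _]] := exists_bump ad dp oU px.
exists b => //; rewrite [b x](_ : _ = 0)//.
by apply/eqP/negPn/negP => /bU[_]; apply.
Qed.

End SmoothFunctions.

(** * Scalar-valued smooth functions *)

Section RealFunctions.
Context {R : realType} (K : scalar_kind).

Definition of_real : R -> scalars R K :=
  match K with
  | RealScalars => fun x => x
  | ComplexScalars => fun x => (x%:C)%C
  end.

Lemma of_real0 : of_real 0 = 0. Proof. by rewrite /of_real; case: K. Qed.

Lemma of_real1 : of_real 1 = 1. Proof. by rewrite /of_real; case: K. Qed.

Lemma of_real_inj : injective of_real.
Proof. by rewrite /of_real; case: K => [x y //|x y []]. Qed.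

Lemma of_realD : {morph of_real : x y / x + y}.
Proof.
rewrite /of_real; case: K => [//|] x y; exact: rmorphD (real_complex R) x y.
Qed.

Lemma of_realM : {morph of_real : x y / x * y}.
Proof.
rewrite /of_real; case: K => [//|] x y; exact: rmorphM (real_complex R) x y.
Qed.

Lemma smooth_of_real (X : manifold R) (g : X -> R) :
  smooth_fun (of_real \o g) <-> smooth_real_fun g.
Proof.
rewrite /of_real; case: K => //=; split=> [[]//|sg]; split=> //.
exact: (smooth_real_fun_cst (X := X) 0).
Qed.

(** [g] is the conjugate of [f], which is [f] for real scalars, and [h] is
    [|f|^2]. *)
Lemma smooth_normsq (X : manifold R) (f : X -> scalars R K) :
  smooth_fun f -> exists g h, [/\ smooth_fun g, smooth_real_fun h,
    forall x, of_real (h x) = f x * g x,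
    forall x, 0 <= h x & forall x, h x = 0 <-> f x = 0].
Proof.
rewrite /of_real; case: K f => /= f.
  move=> sf; exists f, (f * f); split=> // [|x|x].
  - exact: smooth_real_funM.
  - by rewrite !fctE -expr2 sqr_ge0.
  - rewrite !fctE; split=> [/eqP|->]; last by rewrite mulr0.
    by rewrite mulf_eq0 orbb => /eqP.
move=> [sr si]; pose a x := complex.Re (f x); pose b x := complex.Im (f x).
exists (fun x => (f x)^*)%C, (a * a + b * b).
have fE x : f x = (a x +i* b x)%C by rewrite /a /b; case: (f x).
split=> [|||x|x].
- split; last first.
    rewrite (_ : (fun _ => _) = - b); first exact: smooth_real_funN.
    by apply/funext => x; rewrite fE.
  rewrite (_ : (fun _ => _) = a)//.
  by apply/funext => x; rewrite fE.
- by apply: smooth_real_funD; exact: smooth_real_funM.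
- move=> x; rewrite fE; apply/eqP; rewrite eq_complex/= !fctE.
  by apply/andP; split; apply/eqP; ring.
- by rewrite !fctE -!expr2 addr_ge0 ?sqr_ge0.
- rewrite !fctE fE; split=> [/eqP|[-> ->]]; last by rewrite !mulr0 addr0.
  rewrite -!expr2 paddr_eq0 ?sqr_ge0// !sqrf_eq0 => /andP[/eqP-> /eqP->].
  by [].
Qed.

End RealFunctions.

(** * Characters of the algebra of smooth functions *)

Section Characters.
Context {R : realType} {K : scalar_kind} {X : manifold R}.
Implicit Types f g : Cinfty K X.

Lemma Cinfty_ext f g : f =1 g -> f = g.
Proof. by move=> fg; apply/val_inj/funext. Qed.

Lemma exists_Cinfty (f : X -> scalars R K) : smooth_fun f ->
  exists F : Cinfty K X, Cinfty_fun F = f.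
Proof. by move=> /smooth_predP sf; exists (MkCinfty sf). Qed.

Lemma Cinfty_smooth_fun f : smooth_fun (f : X -> scalars R K).
Proof. exact/smooth_predP/Cinfty_smooth. Qed.

Lemma Cinfty_normsq f : exists g h, [/\ smooth_real_fun h,
    forall x, (f * g) x = of_real K (h x),
    forall x, 0 <= h x & forall x, h x = 0 <-> f x = 0].
Proof.
have [g [h [/exists_Cinfty[G GE] sh hE h0 hf]]] :=
  smooth_normsq (Cinfty_smooth_fun f).
by exists G, h; split=> // x; rewrite hE -GE.
Qed.

Lemma closed_zeros f : closed [set x | f x = 0].
Proof.
have [g [h [sh _ _ hf]]] := Cinfty_normsq f.
rewrite (_ : [set _ | _] = h @^-1` [set 0]); last first.
  by apply/seteqP; split=> x /=; rewrite hf.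
apply: closed_comp (@closed_eq _ 0) => x _.
exact: smooth_real_fun_continuous.
Qed.

Lemma Cinfty_separates (x y : X) :
  (forall f, f x = f y) -> x = y.
Proof.
move=> fxy; apply: contrapT => /smooth_real_fun_separates[b].
move=> /(smooth_of_real K)/exists_Cinfty[B BE] /eqP; apply.
by apply: (@of_real_inj _ K); have := fxy B; rewrite BE.
Qed.

Context (chi : Cinfty K X -> (scalars R K)^o).
Context (chiL : linear chi) (chiM : monoid_morphism chi).

Let chi1 : chi 1 = 1. Proof. by case: chiM. Qed.

Let chi_mul f g : chi (f * g) = chi f * chi g. Proof. by case: chiM. Qed.

Let chi_ker_sub f : chi (- chi f *: (1 : Cinfty K X) + f) = 0.
Proof. by rewrite chiL chi1 scaleNr [_ *: 1]mulr1 addNr. Qed.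

(** A function without zeros is invertible, and a character does not vanish on
    invertible functions. *)
Lemma character_kernel_zero f : chi f = 0 -> exists x, f x = 0.
Proof.
move=> f0; apply: contrapT => nf0.
have [g [h [sh hE h0 hf]]] := Cinfty_normsq f.
have hn0 x : h x != 0 by apply/eqP => /hf fx0; apply: nf0; exists x.
have /(smooth_of_real K)/exists_Cinfty[V VE] := smooth_real_funV hn0 sh.
have fgV : f * g * V = 1.
  apply: Cinfty_ext => x; rewrite -[LHS]/((f * g) x * V x) hE VE /= -of_realM.
  by rewrite mulfV// of_real1.
by move: chi1; rewrite -fgV !chi_mul f0 !mul0r => /esym/eqP; rewrite oner_eq0.
Qed.

(** [|f1|^2 + |f2|^2] is in the ideal generated by [f1] and [f2]. *)
Lemma character_kernel_inter f1 f2 : chi f1 = 0 -> chi f2 = 0 ->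
  exists2 f, chi f = 0 & forall x, f x = 0 <-> f1 x = 0 /\ f2 x = 0.
Proof.
move=> f10 f20; have [g1 [h1 [_ h1E h10 hf1]]] := Cinfty_normsq f1.
have [g2 [h2 [_ h2E h20 hf2]]] := Cinfty_normsq f2.
exists (f1 * g1 + f2 * g2).
  by rewrite -[f1 * g1]scale1r chiL !chi_mul f10 f20 !mul0r scaler0 addr0.
move=> x; rewrite -[X in X = 0]/((f1 * g1) x + (f2 * g2) x) h1E h2E -of_realD.
rewrite -hf1 -hf2 -(of_real0 K); split=> [/of_real_inj/eqP|[-> ->]].
  by rewrite paddr_eq0// => /andP[/eqP-> /eqP->].
by rewrite addr0.
Qed.

(** On a compact manifold the zero sets of the functions in the kernel have a
    common point, at which [chi] is the evaluation.  A point exists at all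
    because the only function on the empty manifold is without zeros and in the
    kernel, which excludes that case. *)
Lemma character_eval : compact [set: X] -> exists x, forall f, chi f = f x.
Proof.
move=> cX.
(* the filter generated by the zero sets *)
pose F := [set B : set X | exists2 f, chi f = 0 & [set x | f x = 0] `<=` B].
have chi0 : chi 0 = 0.
  by have := chiL (-1) 0 0; rewrite scaler0 addr0 scaleN1r addNr.
have FF : Filter F.
  split.
  - by exists 0.
  - move=> A B [f f0 fA] [g g0 gB].
    have [h h0 hE] := character_kernel_inter f0 g0.
    by exists h => // x /hE[fx gx]; split; [exact: fA|exact: gB].
  - by move=> A B AB [f f0 fA]; exists f => // x /fA/AB.
have PF : ProperFilter F.
  split=> // -[f f0 fN]; have [x fx0] := character_kernel_zero f0.
  exact: (fN x).
have [x [_ clx]] : [set: X] `&` cluster F !=set0.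
  by apply: cX; exact: filterT.
exists x => f; pose g : Cinfty K X := - chi f *: (1 : Cinfty K X) + f.
have Fg : F [set z | g z = 0] by exists g => //; exact: chi_ker_sub.
have : closure [set z | g z = 0] x by move=> U /(clx _ _ Fg).
rewrite -(closure_id _).1; last exact: closed_zeros.
rewrite -[X in X -> _]/(- chi f * 1 + f x = 0) mulr1 addrC => /eqP.
by rewrite subr_eq0 => /eqP.
Qed.

End Characters.

(** * Maps between manifolds and pullbacks of functions *)

Section Pullback.
Context {R : realType} {Y X : manifold R}.

(** With a bump function [b] around [psi y], the set [b \o psi != 0] is an open
    neighbourhood of [y], on which [u \o psi], for each coordinate [u] of a chart
    at [psi y], is the quotient of [(u * b) \o psi] by [b \o psi]. *)
Lemma smooth_map_pullback (psi : Y -> X) :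
  (forall g, smooth_real_fun g -> smooth_real_fun (g \o psi)) ->
  smooth_map psi.
Proof.
move=> psiP.
have open_neq0 b : smooth_real_fun b -> open [set y | b (psi y) != 0].
  move=> /psiP/smooth_real_fun_continuous cb.
  rewrite (_ : [set _ | _] = (b \o psi) @^-1` [set t | t != 0])//.
  by apply: open_comp; [move=> y _; exact: cb|exact: open_neq].
split.
  apply/continuousP => U oU; rewrite openE => y Uy; rewrite /interior.
  have [d ad dy] := atlas_cover (psi y).
  have [b [sb by0 bU _]] := exists_bump ad dy oU Uy.
  apply: filterS (open_nbhs_nbhs (conj (open_neq0 _ sb) by0)).
  by move=> z /bU[].
move=> c d ac ad k; apply: Ck_on_local => _ [y [cy dy] <-].
have [b [sb by0 _ sdb]] := exists_bump ad dy openT I.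
pose M := [set z | b (psi z) != 0].
have oM : open M by exact: open_neq0.
have oN := chart_image_open (c := c) oM.
exists (chart_map c @` (chart_dom c `&` M)); first by exists y.
have NE : chart_map c @` (chart_dom c `&` M) `<=` chart_map c @` chart_dom c.
  by apply: image_subset => z [].
apply: Ck_on_row => // i.
have sV : Ck_on k (chart_map c @` (chart_dom c `&` M))
    (fun z => (b (psi (chart_inv c z)))^-1).
  apply: (Ck_onV (f := b \o psi \o chart_inv c)) => //.
    by move=> z /chart_dom_inv[].
  exact: Ck_on_subset NE (psiP _ sb c ac k).
apply: Ck_on_ext (Ck_onM oN (Ck_on_subset NE (psiP _ (sdb i) c ac k)) sV) => //.
by move=> z /chart_dom_inv[_ bz _]; rewrite !fctE /= mulfK.
Qed.

Lemma smooth_map_of_algebra (K : scalar_kind) (Psi : Cinfty K X -> Cinfty K Y)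
    (psi : Y -> X) : (forall f y, Psi f y = f (psi y)) -> smooth_map psi.
Proof.
move=> PsiE; apply: smooth_map_pullback => g.
move=> /(smooth_of_real K)/exists_Cinfty[G GE]; apply/(smooth_of_real K).
have := Cinfty_smooth_fun (Psi G).
rewrite (_ : Cinfty_fun _ = of_real K \o (g \o psi))//.
by apply/funext => y; rewrite PsiE GE.
Qed.

(** [psi y] is the point at which the character [f |-> Psi f y] is the
    evaluation. *)
Lemma algebra_morphism_pullback (K : scalar_kind)
    (Psi : Cinfty K X -> Cinfty K Y) : compact [set: X] ->
  linear Psi -> monoid_morphism Psi ->
  exists psi : Y -> X, forall f y, Psi f y = f (psi y).
Proof.
move=> cX PsiL [Psi1 PsiM].
suff /choice[psi psiE] : forall y, exists x, forall f, Psi f y = f x.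
  by exists psi.
move=> y; apply: (character_eval (chi := fun f => Psi f y)) => //.
  by move=> a f g /=; rewrite PsiL.
by split=> [|f g] /=; rewrite ?Psi1 ?PsiM.
Qed.

Lemma algebra_isomorphism_inv (K : scalar_kind) (Psi : Cinfty K X -> Cinfty K Y)
    Phi : cancel Psi Phi -> cancel Phi Psi ->
  algebra_isomorphism Psi -> algebra_isomorphism Phi.
Proof.
move=> PsiK PhiK [PsiL [Psi1 PsiM] _]; split.
- by move=> a f g; apply: (can_inj PsiK); rewrite PsiL !PhiK.
- split=> [|f g]; first by rewrite -Psi1 PsiK.
  by apply: (can_inj PsiK); rewrite PsiM !PhiK.
- by exists Psi.
Qed.

End Pullback.

Theorem theorem5p5 (R : realType) (K : scalar_kind) (X Y : manifold R)
    (X_compact : compact [set: X]) (Y_compact : compact [set: Y])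
    (Psi : Cinfty K X -> Cinfty K Y) (Psi_iso : algebra_isomorphism Psi) :
  exists! psi : Y -> X,
    diffeomorphism psi /\
    forall f : Cinfty K X, Psi f = f \o psi :> (Y -> scalars R K).
Proof.
have [PsiL PsiM [Phi PsiK PhiK]] := Psi_iso.
have [PhiL PhiM _] := algebra_isomorphism_inv PsiK PhiK Psi_iso.
have [psi psiE] := algebra_morphism_pullback X_compact PsiL PsiM.
have [phi phiE] := algebra_morphism_pullback Y_compact PhiL PhiM.
exists psi; split; last first.
  move=> psi' [_ psi'E]; apply/funext => y; apply: (@Cinfty_separates _ K) => f.
  by rewrite -psiE psi'E.
split; last by move=> f; apply/funext => y; exact: psiE.
exists phi; split.
- move=> y; apply: (@Cinfty_separates _ K) => f.
  by rewrite -phiE -psiE PhiK.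
- move=> x; apply: (@Cinfty_separates _ K) => f.
  by rewrite -psiE -phiE PsiK.
- exact: smooth_map_of_algebra psiE.
- exact: smooth_map_of_algebra phiE.
Qed.
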